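(* Let $\beta_1,\beta_2>1$ be two distinct non-integer real numbers. Then $\nu_{-\beta_1}=\nu_{-\beta_2}$ (i.e. the negative $\beta$-transformations $T_{-\beta_1}$ and $T_{-\beta_2}$ have the same absolutely continuous invariant probability measure) if and only if, possibly after interchanging the roles of $\beta_1$ and $\beta_2$, the number $\beta_1$ is a root of the equation $x^2-qx-p=0$ for some positive integers $p,q$ with $p\le q$, and $\beta_2=\beta_1+1$.
   Context: For a real number $\beta>1$, the negative $\beta$-transformation is $T_{-\beta}:(0,1]\to(0,1]$, $T_{-\beta}(x)=-\beta x+\lfloor \beta x\rfloor+1$. It is known that $T_{-\beta}$ has a unique invariant Borel probability measure absolutely continuous with respect to Lebesgue measure on $(0,1]$; it is denoted $\nu_{-\beta}$. Its density is proportional to $h_{-\beta}(x)=\sum_{n\ge 0,\ T_{-\beta}^n(1)\ge x}\frac{1}{(-\beta)^n}$, $x\in(0,1]$. *)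

(* Defs.v *)
From HB Require Import structures.
From mathcomp Require Import all_boot all_order all_algebra.
From mathcomp Require Import all_classical all_reals all_analysis.
From mathcomp Require Import giry.

Set Implicit Arguments.
Unset Strict Implicit.
Unset Printing Implicit Defensive.

Import Order.TTheory GRing.Theory Num.Theory.
Import numFieldNormedType.Exports.

Local Open Scope classical_set_scope.
Local Open Scope ring_scope.

(* The formula of the negative beta-transformation, read on the whole line;
   all its values lie in ]0, 1] (see [negbeta_itv]), so it restricts to a
   self-map of ]0, 1]. *)
Definition negbeta (R : realType) (b x : R) : R :=
  - (b * x) + (Num.floor (b * x))%:~R + 1.

Lemma negbeta_itv (R : realType) (b x : R) : `]0, 1]%classic (negbeta b x).
Proof.
rewrite /negbeta /= in_itv /=; have /andP[h1 h2] := floor_itv (b * x).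
rewrite intrD in h2; apply/andP; split.
  by rewrite -addrA addrC subr_gt0.
by rewrite gerDr addrC subr_le0.
Qed.

(* A Borel probability measure on ]0, 1] is a probability on the Borel sets of
   R that gives mass 1 to ]0, 1]. *)
Definition is_acip (R : realType) (b : R)
    (nu : probability (measurableTypeR R) R) : Prop :=
  [/\ nu `]0, 1]%classic = 1%E,
      forall A : set (measurableTypeR R), measurable A ->
        nu (negbeta b @^-1` A) = nu A
    & nu `<< (@lebesgue_measure R)].

(* [is_nu_negbeta b nu] is the definite description "nu is the absolutely
   continuous invariant probability of the negative b-transformation".
   A library measure is a function on all subsets, unconstrained outside the
   sigma-algebra, so equality of measures is [measure_eq] (agreement on all
   measurable sets), not Leibniz equality. *)
Definition is_nu_negbeta (R : realType) (b : R)
    (nu : probability (measurableTypeR R) R) : Prop :=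
  is_acip b nu /\
  forall mu : probability (measurableTypeR R) R,
    is_acip b mu -> measure_eq mu nu.

Definition quadratic_shift (R : realType) (b c : R) : Prop :=
  exists p q : nat,
    [/\ (0 < p)%N, (0 < q)%N, (p <= q)%N,
        b ^+ 2 - q%:R * b - p%:R = 0
      & c = b + 1].

(* Main.v *)
(* Write T for the negative b-transformation, t_n = T^n(1) and w = -1/b.
   Counting branches gives
     leb(T^-1 A /\ ]0, t]) + leb(A /\ ]0, T t]) / b = (t + T t / b) leb(A /\ ]0, 1]),
   so that the signed measure mu_b = sum_n w^n leb(. /\ ]0, t_n]) is invariant.
   Its positive and negative parts are then invariant too, and uniqueness of
   the invariant probability nu_b makes mu_b a multiple of nu_b; the multiple
   is nonzero because the density of mu_b tends to 1/(1 - w) at 0.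

   If nu_b1 = nu_b2 then mu_b1 = kappa mu_b2, so the densities have
   proportional limits at 0 and proportional jumps. The jump at y is
   J(y) = sum of w^n over the times n with t_n = y, that is w^n Q(y) for the
   first such n, where Q(y) <> 0 is 1 if y is not periodic and is constant
   along the cycle otherwise. If 1 is periodic for neither map, the jumps at 1
   give kappa = 1 and the limits at 0 give b1 = b2. If 1 is periodic for T_2
   and two distinct points among 1, T_2(1), T_2^2(1) are both periodic or both
   non-periodic for T_1, comparing exponents again gives b1 = b2. Otherwise
   T_2^2(1) = 1 and T_1(1) is a fixed point of T_1, which amounts to
   b2 = b1 + 1 with b1 (b1 - floor b1) an integer. Conversely, for such b1, b2
   both series can be summed and are proportional. *)
From HB Require Import structures.
Require Import Defs.
From mathcomp Require Import all_boot all_order all_algebra.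
From mathcomp Require Import all_classical all_reals all_analysis.
From mathcomp Require Import measurable_realfun giry.
From mathcomp Require Import zify ring lra.

Set Implicit Arguments.
Unset Strict Implicit.
Unset Printing Implicit Defensive.

Import Order.TTheory GRing.Theory Num.Theory.
Import numFieldNormedType.Exports.

Local Open Scope classical_set_scope.
Local Open Scope ring_scope.

(** * Geometrically weighted series *)

(** For [|w| < 1] and bounded [f] the series converges absolutely, so this [limn] is a genuine sum;
    hence the bounds [M] below. *)
Definition wsum (R : realType) (w : R) (f : nat -> R) : R :=
  limn (series (fun n => w ^+ n * f n)).

Section wsum.
Context {R : realType}.
Context (w : R) (w1 : `|w| < 1).
Implicit Types (f g : nat -> R) (M : R) (n k : nat).

Lemma cvg_wsum M f : (forall n, `|f n| <= M) ->
  series (fun n => w ^+ n * f n) @ \oo --> wsum w f.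
Proof.
move=> fM; apply: normed_cvg.
apply: (@series_le_cvg _ _ (geometric M `|w|)) => [n|n|n|]; rewrite /geometric/=.
- exact: normr_ge0.
- by rewrite mulr_ge0 ?exprn_ge0// (le_trans _ (fM 0)).
- by rewrite normrM normrX mulrC ler_wpM2r// exprn_ge0.
- by apply: is_cvg_geometric_series; rewrite normr_id.
Qed.

Lemma eq_wsum f g : f =1 g -> wsum w f = wsum w g.
Proof. by move=> /funext ->. Qed.

Lemma wsum_lim M f (l : R) : (forall n, `|f n| <= M) ->
  series (fun n => w ^+ n * f n) @ \oo --> l -> wsum w f = l.
Proof. by move=> /cvg_wsum fM fl; exact: cvg_unique fM fl. Qed.

Lemma wsum_cst c : wsum w (fun=> c) = c / (1 - w).
Proof.
apply: (@wsum_lim `|c|) => [//|].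
rewrite (_ : (fun n => _) = geometric c w); first exact: cvg_geometric_series.
by apply/funext => n; rewrite /geometric/= mulrC.
Qed.

Lemma wsum0 f : (forall n, f n = 0) -> wsum w f = 0.
Proof. by move=> f0; rewrite (eq_wsum (g := fun=> 0))// wsum_cst mul0r. Qed.

Lemma wsumD M M' f g : (forall n, `|f n| <= M) -> (forall n, `|g n| <= M') ->
  wsum w (fun n => f n + g n) = wsum w f + wsum w g.
Proof.
move=> fM gM'; apply: (@wsum_lim (M + M')) => [n|].
  by rewrite (le_trans (ler_normD _ _))// lerD.
rewrite (_ : series _ = series (fun n => w ^+ n * f n) \+ series (fun n => w ^+ n * g n)).
  by apply: cvgD; [exact: cvg_wsum fM|exact: cvg_wsum gM'].
apply/funext => n /=; rewrite /series/= -big_split/=.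
by apply: eq_bigr => i _; rewrite mulrDr.
Qed.

Lemma wsumZ M c f : (forall n, `|f n| <= M) ->
  wsum w (fun n => c * f n) = c * wsum w f.
Proof.
move=> fM; apply: (@wsum_lim (`|c| * M)) => [n|].
  by rewrite normrM ler_wpM2l.
rewrite (_ : series _ = c \*: series (fun n => w ^+ n * f n)).
  by apply: cvgZr; exact: cvg_wsum fM.
apply/funext => n /=; rewrite /series/= scaler_sumr.
by apply: eq_bigr => i _; rewrite mulrCA.
Qed.

Lemma wsumB M M' f g : (forall n, `|f n| <= M) -> (forall n, `|g n| <= M') ->
  wsum w (fun n => f n - g n) = wsum w f - wsum w g.
Proof.
move=> fM gM'; rewrite -(mulN1r (wsum w g)) -(wsumZ _ gM') -(wsumD fM (M' := M')).
  by apply: eq_wsum => n; rewrite mulN1r.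
by move=> n; rewrite mulN1r normrN.
Qed.

Lemma ler_norm_wsum M f : (forall n, `|f n| <= M) ->
  `|wsum w f| <= M / (1 - `|w|).
Proof.
move=> fM; have fc := cvg_wsum fM; rewrite -(cvg_lim _ (cvg_norm fc))//.
have gc : series (geometric M `|w|) @ \oo --> M / (1 - `|w|).
  by apply: cvg_geometric_series; rewrite normr_id.
rewrite -(cvg_lim _ gc)//; apply: ler_lim.
- by apply/cvg_ex; exists (`|wsum w f|); exact: cvg_norm fc.
- by apply/cvg_ex; eexists; exact: gc.
- apply: nearW => n /=; rewrite /series/= (le_trans (ler_norm_sum _ _ _))//.
  apply: ler_sum => i _.
  by rewrite /geometric/= normrM normrX mulrC ler_wpM2r// exprn_ge0.
Qed.

Lemma wsum_recl M f : (forall n, `|f n| <= M) ->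
  wsum w f = f 0 + w * wsum w (fun n => f n.+1).
Proof.
move=> fM; have fM' n : `|f n.+1| <= M by [].
apply: (wsum_lim fM); rewrite -cvg_shiftS/=.
rewrite (_ : (fun n => _) =
    (fun n => f 0 + w * series (fun n => w ^+ n * f n.+1) n)); last first.
  apply/funext => n; rewrite /series/= big_nat_recl//= expr0 mul1r mulr_sumr.
  by congr (_ + _); apply: eq_bigr => i _; rewrite exprS mulrA.
by apply: cvgD; [exact: cvg_cst|apply: cvgMr; exact: cvg_wsum fM'].
Qed.

Lemma wsum_split M k f : (forall n, `|f n| <= M) ->
  wsum w f = \sum_(n < k) w ^+ n * f n + w ^+ k * wsum w (fun n => f (n + k)%N).
Proof.
move=> fM; elim: k => [|k IH].
  by rewrite big_ord0 add0r expr0 mul1r; apply: eq_wsum => n; rewrite addn0.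
rewrite IH big_ord_recr/= -addrA; congr (_ + _).
rewrite (@wsum_recl M)// add0n mulrDr mulrA -exprSr; congr (_ + _ * _).
by apply: eq_wsum => n; rewrite addSnnS.
Qed.

(* A form of Tannery's theorem. *)
Lemma cvg_wsum_near (F : set_system R) {FF : ProperFilter F} M
    (u : R -> nat -> R) (v : nat -> R) :
  (forall x n, `|u x n| <= M) -> (forall n, `|v n| <= M) ->
  (forall n, \forall x \near F, u x n = v n) ->
  (fun x => wsum w (u x)) @ F --> wsum w v.
Proof.
move=> uM vM uv; apply/cvgrPdist_le => e e0.
have M0 : 0 <= M by exact: le_trans (vM 0).
have nuv x n : `|v n - u x n| <= M + M.
  by rewrite (le_trans (ler_normB _ _))// lerD.
(* Cut at [k]: the tail is at most [e] uniformly in [x], and the finitely many earlier differences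
   vanish near [F]. *)
have [k ke] : exists k, `|w| ^+ k * ((M + M) / (1 - `|w|)) <= e.
  have : geometric ((M + M) / (1 - `|w|)) `|w| @ \oo --> (0 : R).
    by apply: cvg_geometric; rewrite normr_id.
  move=> /cvgrPdist_le /(_ e e0)[k _ /(_ k (leqnn k))] /=.
  rewrite sub0r normrN /geometric/= => h; exists k; apply: le_trans h.
  by rewrite mulrC ler_norm.
have uvk : \forall x \near F, forall n : 'I_k, u x n = v n.
  by apply: filter_forall => n; exact: uv.
near=> x.
have uvx : forall n : 'I_k, u x n = v n by near: x; exact: uvk.
rewrite -(wsumB vM (uM x)) (wsum_split k (nuv x)) big1 => [|i _]; last first.
  by rewrite uvx subrr mulr0.
rewrite add0r normrM normrX (le_trans _ ke)// ler_wpM2l ?exprn_ge0//.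
by apply: ler_norm_wsum => n; exact: nuv.
Unshelve. all: by end_near. Qed.

End wsum.

(** * The negative beta-transformation and Lebesgue measure *)

(** By uniqueness of Lebesgue measure: [b] times its pushforward under the affine map gives
    half-open intervals their length. *)
Lemma lebesgue_measure_affine {R : realType} (b c : R)
    (A : set (measurableTypeR R)) : 0 < b -> measurable A ->
  lebesgue_measure ((fun x => c - b * x) @^-1` A) =
  (b^-1%:E * lebesgue_measure A)%E.
Proof.
move=> b0 mA; have b0' := ltW b0.
pose f (x : measurableTypeR R) : measurableTypeR R := c - b * x.
have mf : measurable_fun [set: measurableTypeR R] f.
  by apply: (measurable_funB (f := cst c)) => //; exact: (measurable_funM (f := cst b)).
pose m := mscale (NngNum b0') (pushforward lebesgue_measure f).
have -> : lebesgue_measure A = m mf A.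
  rewrite /m; apply: lebesgue_measure_unique => // _ [[u v] _ <-].
  rewrite /= /mscale /pushforward /=.
  rewrite [X in (_ * lebesgue_measure X)%E](_ : _ =
      `[(c - v) / b, (c - u) / b[%classic); last first.
    apply/seteqP; split => x/=; rewrite !in_itv/= /f.
      by rewrite ler_pdivrMr// ltr_pdivlMr// => /andP[? ?]; lra.
    by rewrite ler_pdivrMr// ltr_pdivlMr// => /andP[? ?]; lra.
  rewrite !lebesgue_measure_itv/= !lte_fin ltr_pM2r ?invr_gt0// ltrD2l ltrN2.
  case: ifPn => // _; last by rewrite mule0.
  rewrite -!EFinB -EFinM; congr EFin; field; exact: lt0r_neq0.
by rewrite /m /mscale/= muleA -EFinM mulVf ?gt_eqF// mul1e.
Qed.

Lemma measurable_negbeta {R : realType} (b : R) : 0 <= b ->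
  measurable_fun [set: measurableTypeR R] (negbeta b : _ -> measurableTypeR R).
Proof.
move=> b0; apply: measurable_funD => //; apply: measurable_funD.
  by apply: measurable_funN; exact: (measurable_funM (f := cst b)).
apply: nondecreasing_measurable => // x y xy.
by rewrite ler_int; apply: le_floor; rewrite ler_wpM2l.
Qed.

(** The measure with density the indicator of []0, t]], real-valued so that it can be a term of
    [wsum]. *)
Definition len (R : realType) (t : R) (A : set (measurableTypeR R)) : R :=
  fine (lebesgue_measure (A `&` `]0, t]%classic)).

Section len.
Context {R : realType}.
Implicit Types (t x : R) (A B C : set (measurableTypeR R)).

Lemma len_EFin t A : measurable A ->
  lebesgue_measure (A `&` `]0, t]) = (len t A)%:E.
Proof.
move=> mA; rewrite /len fineK// ge0_fin_numE//.
apply: (@le_lt_trans _ _ (lebesgue_measure `]0, t]%classic)).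
  by apply: le_measure; rewrite ?inE//; exact: measurableI.
by rewrite lebesgue_measure_itv/=; case: ifP => _; rewrite ?ltry// -EFinB ltry.
Qed.

Lemma len_ge0 t A : 0 <= len t A.
Proof. exact: fine_ge0. Qed.

Lemma le_len t t' A : measurable A -> t <= t' -> len t A <= len t' A.
Proof.
move=> mA tt'; rewrite -lee_fin -!len_EFin//; apply: le_measure; rewrite ?inE.
- exact: measurableI.
- exact: measurableI.
- apply: setIS => x /=; rewrite !in_itv/= => /andP[-> /=].
  by move=> /le_trans; exact.
Qed.

Lemma len_setU t A B : measurable A -> measurable B -> A `&` B = set0 ->
  len t (A `|` B) = len t A + len t B.
Proof.
move=> mA mB AB; apply: EFin_inj.
rewrite EFinD -!len_EFin//; last exact: measurableU.
rewrite setIUl measureU//; [exact: measurableI|exact: measurableI|].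
by rewrite setIACA AB set0I.
Qed.

Lemma len_itvoc t x : 0 <= t -> 0 <= x -> len t `]0, x]%classic = Num.min x t.
Proof.
move=> t0 x0; rewrite /len (_ : _ `&` _ = `]0, Num.min x t]%classic).
  have : 0 <= Num.min x t by rewrite le_min x0.
  move: (Num.min x t) => m m0.
  rewrite lebesgue_measure_itv/= lte_fin; case: ltP => [_|m0'] /=.
    by rewrite oppr0 addr0.
  by apply/esym/le_anti; rewrite m0'.
apply/seteqP; split => y /=; rewrite !in_itv/= le_min.
  by move=> [/andP[-> ->] /andP[_ ->]].
by move=> /and3P[-> -> ->].
Qed.

Lemma lebesgue_measureI_setU1 A C x : measurable A -> measurable C ->
  lebesgue_measure (A `&` (C `|` [set x])) = lebesgue_measure (A `&` C).
Proof.
move=> mA mC; have mAC : measurable (A `&` C) by exact: measurableI.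
have mAx : measurable (A `&` [set x]) by exact: measurableI.
apply/eqP; rewrite eq_le; apply/andP; split; last first.
  apply: le_measure; rewrite ?inE//; last by apply: setIS; exact: subsetUl.
  by apply: measurableI => //; exact: measurableU.
rewrite setIUr (le_trans (measureU2 _ mAC mAx))//.
rewrite [X in (_ + X)%E](_ : _ = 0%E) ?adde0//.
apply/eqP; rewrite eq_le measure_ge0 andbT -(lebesgue_measure_set1 x).
by apply: le_measure; rewrite ?inE//; exact: subIsetr.
Qed.

Lemma negbeta_branch (b x : R) (k : nat) : k%:R <= b * x < k.+1%:R ->
  negbeta b x = k.+1%:R - b * x.
Proof.
move=> kx; rewrite /negbeta (_ : Num.floor (b * x) = k%:Z).
  by rewrite -[k.+1%:R]natr1/=; ring.
by apply: floor_def; rewrite -[k.+1%:R]natr1 in kx; rewrite intrD/=.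
Qed.

(** Each branch [[k/b, (k+1)/b[] is mapped affinely with slope [-b] onto []0, 1]], and contributes
    one copy of [A] scaled by [1/b]. *)
Lemma lebesgue_measure_negbeta_branches (b : R) A (k : nat) :
  0 < b -> measurable A ->
  lebesgue_measure (negbeta b @^-1` A `&` `[0, k%:R / b[) =
  ((k%:R / b)%:E * lebesgue_measure (A `&` `]0%R, 1%R]))%E.
Proof.
move=> b0 mA; have mT : measurable (negbeta b @^-1` A).
  by rewrite -[X in measurable X]setTI; exact: (measurable_negbeta (ltW b0)).
elim: k => [|k IH].
  by rewrite !mul0r mul0e set_itvco0 setI0 measure0.
have kk1 : k%:R / b <= k.+1%:R / b by rewrite ler_pM2r ?invr_gt0// ler_nat.
have k0 : 0 <= k%:R / b by rewrite divr_ge0// ltW.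
rewrite (_ : `[0, k.+1%:R / b[%classic =
  `[0, k%:R / b[%classic `|` `[k%:R / b, k.+1%:R / b[%classic); last first.
  by rewrite -itv_bndbnd_setU ?bnd_simp.
rewrite setIUr measureU; first last.
- rewrite setIACA [X in _ `&` X](_ : _ = set0) ?setI0//.
  apply/seteqP; split => // x [/=]; rewrite !in_itv/= => /andP[_].
  by move=> /lt_geF ->.
- exact: measurableI.
- exact: measurableI.
rewrite [X in (X + _)%E = _]IH.
rewrite [X in (_ + lebesgue_measure X)%E](_ : _ =
    (fun x => k.+1%:R - b * x) @^-1` (A `&` `]0, 1])); last first.
  apply/seteqP; split => x /=; rewrite !in_itv/= ler_pdivrMr// ltr_pdivlMr//.
    move=> [Ax kx]; have /andP[kx1 kx2] := kx.
    rewrite mulrC in kx; rewrite -(negbeta_branch kx); split=> //.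
    by rewrite (negbeta_branch kx); rewrite -[k.+1%:R]natr1 in kx2 *; apply/andP; split; lra.
  rewrite -[k.+1%:R]natr1 => -[Ax /andP[kx1 kx2]].
  have kx : k%:R <= b * x < k.+1%:R by rewrite -[k.+1%:R]natr1; apply/andP; split; lra.
  by rewrite (negbeta_branch kx) -[k.+1%:R]natr1; split=> //; apply/andP; split; lra.
rewrite lebesgue_measure_affine//; last exact: measurableI.
rewrite -ge0_muleDl ?lee_fin ?invr_ge0 ?(ltW b0)//.
by rewrite -EFinD -[k.+1%:R]natr1; congr (_%:E * _)%E; ring.
Qed.

(** Up to an endpoint, []0, t]] consists of [k] full branches and a piece mapped onto
    [[negbeta b t, 1]]; the term over []0, negbeta b t]] completes that piece, making [k + 1] full
    branches. *)
Lemma len_negbeta (b t : R) A : 0 < b -> 0 <= t -> measurable A ->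
  len t (negbeta b @^-1` A) + b^-1 * len (negbeta b t) A =
  (t + b^-1 * negbeta b t) * len 1 A.
Proof.
move=> b0 t0 mA; have mT : measurable (negbeta b @^-1` A).
  by rewrite -[X in measurable X]setTI; exact: (measurable_negbeta (ltW b0)).
have bt0 : 0 <= b * t by rewrite mulr_ge0// ltW.
have [k kt] : exists k : nat, k%:R <= b * t < k.+1%:R.
  by exists (Num.truncn (b * t)); exact: truncn_itv.
have /andP[kt1 kt2] := kt.
have -> : t + b^-1 * negbeta b t = k%:R / b + b^-1.
  by rewrite (negbeta_branch kt) -[k.+1%:R]natr1; field; exact: lt0r_neq0.
have /andP[T0 T1] : 0 < negbeta b t <= 1 by have := negbeta_itv b t; rewrite /= in_itv.
apply: EFin_inj; rewrite EFinD !EFinM -!len_EFin//.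
(* Points are null, so endpoints may be moved until the intervals fit: [[0, k/b[] with [[k/b, t]],
   and []0, negbeta b t[] with [[negbeta b t, 1]]. *)
have -> : lebesgue_measure (A `&` `]0, negbeta b t]) =
    lebesgue_measure (A `&` `]0, negbeta b t[).
  by rewrite -(setUitv1 true)// ?lebesgue_measureI_setU1//= bnd_simp.
have -> : lebesgue_measure (negbeta b @^-1` A `&` `]0, t]) =
    lebesgue_measure (negbeta b @^-1` A `&` `[0, t]).
  by rewrite -(setU1itv false)// 1?setUC ?lebesgue_measureI_setU1//= bnd_simp.
rewrite (@itv_bndbnd_setU _ _ _ (BLeft (k%:R / b)) (BRight t)) ?bnd_simp; last 2 first.
- by rewrite divr_ge0// ltW.
- by rewrite ler_pdivrMr// mulrC.
rewrite setIUr measureU; first last.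
- rewrite setIACA [X in _ `&` X](_ : _ = set0) ?setI0//.
  apply/seteqP; split => // x [/=]; rewrite !in_itv/= => /andP[_].
  by move=> /lt_geF ->.
- exact: measurableI.
- exact: measurableI.
rewrite [X in (X + _ + _)%E]lebesgue_measure_negbeta_branches//.
rewrite [X in (_ + lebesgue_measure X + _)%E](_ : _ =
    (fun x => k.+1%:R - b * x) @^-1` (A `&` `[negbeta b t, 1])); last first.
  apply/seteqP; split => x /=; rewrite !in_itv/= ler_pdivrMr//.
    move=> [Ax /andP[kx1 kx2]].
    have bxt : b * x <= b * t by rewrite ler_pM2l.
    have kx : k%:R <= b * x < k.+1%:R by apply/andP; split; lra.
    rewrite -(negbeta_branch kx); split=> //.
    by rewrite !(negbeta_branch kx, negbeta_branch kt) -[k.+1%:R]natr1; apply/andP; split; lra.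
  rewrite (negbeta_branch kt) -[k.+1%:R]natr1 => -[Ax /andP[kx1 kx2]].
  have kx : k%:R <= b * x < k.+1%:R by rewrite -[k.+1%:R]natr1; move: kt2; rewrite -[k.+1%:R]natr1 => kt2; apply/andP; split; lra.
  rewrite (negbeta_branch kx) -[k.+1%:R]natr1; split=> //; apply/andP; split; first lra.
  by rewrite -(ler_pM2l b0); lra.
rewrite lebesgue_measure_affine//; last exact: measurableI.
rewrite -addeA -ge0_muleDr//.
rewrite [X in (_ + _ * X)%E](_ : _ = lebesgue_measure (A `&` `]0, 1])); last first.
  rewrite (@itv_bndbnd_setU _ _ (BRight 0) (BLeft (negbeta b t)) (BRight 1)) ?bnd_simp//.
  rewrite setIUr measureU 1?addeC//.
  - exact: measurableI.
  - exact: measurableI.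
  rewrite setIACA [X in _ `&` X](_ : _ = set0) ?setI0//.
  apply/seteqP; split => // x [/=]; rewrite !in_itv/= => /andP[_].
  by move=> /lt_geF ->.
by rewrite EFinD ge0_muleDl// lee_fin ?divr_ge0 ?invr_ge0// ltW.
Qed.

End len.

(** * Invariant charges *)

Section charge_below_lebesgue.
Context {R : realType}.
Local Notation T := (measurableTypeR R).
Implicit Types (A B : set T).

Lemma cvg_len_tail (F : (set T)^nat) : (forall i, measurable (F i)) ->
  trivIset setT F ->
  len 1 (\bigcup_(n in [set n | (k <= n)%N]) F n) @[k --> \oo] --> (0 : R).
Proof.
move=> mF tF; pose D k := \bigcup_(n in [set n | (k <= n)%N]) F n.
have mD k : measurable (D k) by exact: bigcup_measurable.
have D0 : \bigcap_k (D k `&` `]0, 1]) = set0.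
  apply/seteqP; split => // x Dx; have [[i _ Fix] _] := Dx 0%N I.
  have [[j /= ij Fjx] _] := Dx i.+1 I.
  have := tF i j I I (ex_intro _ x (conj Fix Fjx)) => ij'.
  by rewrite ij' ltnn in ij.
have mD1 k : measurable (D k `&` `]0, 1]) by exact: measurableI.
have cvgD : lebesgue_measure (D k `&` `]0, 1]%classic) @[k --> \oo] -->
    lebesgue_measure (\bigcap_k (D k `&` `]0, 1]%classic)).
  apply: nonincreasing_cvg_mu => //.
  - by rewrite /= len_EFin// ltry.
  - exact: bigcap_measurable.
  - move=> m n mn; apply/subsetPset; apply: setSI => x [i /= ni Fix].
    by exists i => //=; exact: leq_trans ni.
by move: cvgD; rewrite D0 measure0 => /fine_cvgP[].
Qed.

(** Domination by length upgrades finite to countable additivity: the error after [n] sets is [m] of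
    the union of the others, whose length in []0, 1]] tends to 0. *)
Lemma charge_of_additive (m : set T -> R) (C : R) :
  (forall A B, measurable A -> measurable B -> A `&` B = set0 ->
    m (A `|` B) = m A + m B) ->
  (forall A, measurable A -> `|m A| <= C * len 1 A) ->
  exists nu : {charge set T -> \bar R}, forall A, nu A = (m A)%:E.
Proof.
move=> mD mC; pose nu A := (m A)%:E.
have nu0 : nu set0 = 0%E.
  rewrite /nu; congr EFin; have := mD set0 set0 measurable0 measurable0 (setI0 _).
  by rewrite setU0; lra.
have nu_fin A : measurable A -> nu A \is a fin_num by [].
have nu_sigma : semi_sigma_additive nu.
  move=> F mF tF mUF; pose D k := \bigcup_(n in [set n | (k <= n)%N]) F n.
  have mDk k : measurable (D k) by exact: bigcup_measurable.
  have DS k : m (D k) = m (F k) + m (D k.+1).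
    rewrite -mD//; first congr m.
      apply/seteqP; split => [x [i /= ki Fix]|x [Fkx|[i /= ki Fix]]].
      - move: ki; rewrite leq_eqVlt => /orP[/eqP ->|ki]; [by left|right].
        by exists i.
      - by exists k => /=.
      - by exists i => //=; exact: ltnW.
    apply/seteqP; split => // x [Fkx [i /= ki Fix]].
    have := tF k i I I (ex_intro _ x (conj Fkx Fix)) => ki'.
    by rewrite ki' ltnn in ki.
  have -> : (fun n => (\sum_(0 <= i < n) nu (F i))%E) =
      (fun n => (m (\bigcup_i F i) - m (D n))%:E).
    apply/funext; elim => [|n IH].
      rewrite big_geq//; congr EFin.
      rewrite (_ : D 0%N = \bigcup_i F i) ?subrr//.
      by rewrite /D; congr bigcup; apply/seteqP; split.
    rewrite big_nat_recr//= IH -EFinD; congr EFin; rewrite DS; ring.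
  apply: cvg_EFin; first exact: nearW.
  rewrite -[X in _ --> X]subr0; apply: cvgB; first exact: cvg_cst.
  apply/norm_cvg0P; apply: (@squeeze_cvgr _ _ _ _ (cst 0) (fun k => C * len 1 (D k))).
  - by apply: nearW => k /=; rewrite normr_ge0/= mC.
  - exact: cvg_cst.
  - rewrite -[X in _ --> X](mulr0 C); apply: cvgMr; exact: cvg_len_tail.
pose c : {charge set T -> \bar R} := HB.pack nu (isCharge.Build _ _ _ nu nu0 nu_fin nu_sigma).
by exists c.
Qed.

(** Unless it is zero, [p] normalises to an absolutely continuous invariant probability, which must
    be [nu]. *)
Lemma invariant_measure_unique (b C : R) (nu : probability T R)
    (p : {measure set T -> \bar R}) : is_nu_negbeta b nu ->
  (forall A, measurable A -> p (negbeta b @^-1` A) = p A) ->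
  (forall A, measurable A -> (p A <= (C * len 1 A)%:E)%E) ->
  exists a : R, forall A, measurable A -> p A = (a%:E * nu A)%E.
Proof.
move=> [_ nuU] pT pC.
have poo : p [set: T] != +oo%E by rewrite lt_eqF// (le_lt_trans (pC _ measurableT))// ltry.
have [p0|p0] := eqVneq (p [set: T]) 0%E.
  exists 0 => A mA; rewrite mul0e; apply/eqP; rewrite eq_le measure_ge0 andbT.
  by rewrite -p0; apply: le_measure; rewrite ?inE.
(* Here [nu] is only the default of [mnormalize] for total mass zero or infinite, both excluded by
   now. *)
pose q : probability T R := mnormalize p nu.
have qE A : q A = (p A * (fine (p [set: T]))^-1%:E)%E.
  by rewrite /q/= /mnormalize (negbTE p0) (negbTE poo).
have qac A : measurable A -> len 1 A = 0 -> q A = 0%E.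
  move=> mA A0; rewrite qE (_ : p A = 0%E) ?mul0e//.
  apply/eqP; rewrite eq_le measure_ge0 andbT.
  by rewrite (le_trans (pC _ mA))// A0 mulr0.
have pfin : p [set: T] \is a fin_num by rewrite ge0_fin_numE// ltey.
have pf0 : fine (p [set: T]) != 0 by rewrite fine_eq0.
have qacip : is_acip b q.
  split => [|B mB|].
  - have : q (~` `]0, 1]%classic) = 0%E.
      apply: qac; first exact: measurableC.
      by rewrite /len setICl measure0.
    rewrite probability_setC// -(@fineK _ (q `]0, 1]%classic)) ?fin_num_measure//.
    by rewrite -EFinB => -[h]; congr EFin; lra.
  - by rewrite [LHS]qE [RHS]qE pT.
  - apply/null_content_dominatesP => B mB B0; apply: qac => //.
    rewrite /len (_ : lebesgue_measure _ = 0%E)//.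
    apply/eqP; rewrite eq_le measure_ge0 andbT -B0.
    by apply: le_measure; rewrite ?inE//; exact: measurableI.
exists (fine (p [set: T])) => A mA.
have <- : q A = nu A by exact: nuU.
by rewrite qE muleCA -EFinM divff// mule1.
Qed.

(* Both parts of the Hahn decomposition [P], [N] of an invariant charge are
   invariant: [c P = c (T^-1 P)] forces [T^-1 P] to differ from [P] by a
   [c]-null set. So each part is a multiple of the unique invariant measure. *)
Lemma invariant_charge_unique (b C : R) (nu : probability T R)
    (m : set T -> R) : 0 <= b -> is_nu_negbeta b nu ->
  (forall A B, measurable A -> measurable B -> A `&` B = set0 ->
    m (A `|` B) = m A + m B) ->
  (forall A, measurable A -> `|m A| <= C * len 1 A) ->
  (forall A, measurable A -> m (negbeta b @^-1` A) = m A) ->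
  exists a : R, forall A, measurable A -> (m A)%:E = (a%:E * nu A)%E.
Proof.
move=> b0 nuP mD mC mT; have [c cE] := charge_of_additive mD mC.
have mpre A : measurable A -> measurable (negbeta b @^-1` A).
  by move=> mA; rewrite -[X in measurable X]setTI; exact: measurable_negbeta.
have [P [N PN]] := Hahn_decomposition c.
have [[mP posP] [mN negN] PUN PIN] := PN.
have P0 A : measurable A -> A `<=` P -> 0 <= m A.
  by move=> mA /(posP _ mA); rewrite cE lee_fin.
have N0 A : measurable A -> A `<=` N -> m A <= 0.
  by move=> mA /(negN _ mA); rewrite cE lee_fin.
have split_m A B : measurable A -> measurable B -> m A = m (A `&` B) + m (A `&` ~` B).
  move=> mA mB; rewrite -mD; first by rewrite -setIUr setUv setIT.
  - exact: measurableI.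
  - by apply: measurableI => //; exact: measurableC.
  - by rewrite setIACA setICr setI0.
have NE : N = ~` P.
  apply/seteqP; split => x; last first.
    by move=> nPx; have : (P `|` N) x by [rewrite PUN]; case.
  by move=> Nx Px; have : (P `&` N) x by []; rewrite PIN.
pose X := negbeta b @^-1` P; have mX : measurable X by exact: mpre.
have XN : m (X `&` N) <= 0 by apply: N0; [exact: measurableI|exact: subIsetr].
have PX : 0 <= m (P `&` ~` X).
  by apply: P0; [apply: measurableI => //; exact: measurableC|exact: subIsetl].
(* By invariance [m X = m P]; removing the common part of [X] and [P] leaves a nonpositive number
   equal to a nonnegative one. *)
have [XN0 PX0] : m (X `&` N) = 0 /\ m (P `&` ~` X) = 0.
  have := split_m X P mX mP; have := split_m P X mP mX; rewrite -NE mT// setIC.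
  by move: XN PX; split; lra.
have mI := @measurableI _ T; have mCC := @measurableC _ T.
(* A measurable piece of the null set and its remainder both have nonpositive charge and sum to 0,
   so each vanishes; [null2] is symmetric. *)
have null1 A : measurable A -> A `<=` X `&` N -> m A = 0.
  move=> mA AXN; have AN : A `<=` N by move=> x /AXN[].
  have /= h1 := split_m (X `&` N) A (mI _ _ mX mN) mA.
  rewrite (setIidr AXN) XN0 in h1.
  have h2 := N0 _ mA AN.
  have h3 : m (X `&` N `&` ~` A) <= 0.
    by apply: N0; [apply: measurableI; [exact: measurableI|exact: measurableC]|move=> x [[]]].
  lra.
have null2 A : measurable A -> A `<=` P `&` ~` X -> m A = 0.
  move=> mA APX; have AP : A `<=` P by move=> x /APX[].
  have /= h1 := split_m (P `&` ~` X) A (mI _ _ mP (mCC _ mX)) mA.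
  rewrite (setIidr APX) PX0 in h1.
  have h2 := P0 _ mA AP.
  have h3 : 0 <= m (P `&` ~` X `&` ~` A).
    by apply: P0; [apply: measurableI; [apply: measurableI => //; exact: measurableC|exact: measurableC]|move=> x [[]]].
  lra.
(* The preimage of the part of [A] in [P] is cut out by [X] instead of [P]; the two cuts differ only
   inside the null sets above. *)
have inv A : measurable A -> m (negbeta b @^-1` A `&` P) = m (A `&` P).
  move=> mA; have mTA := mpre _ mA.
  rewrite -[RHS]mT; last exact: measurableI.
  rewrite preimage_setI -/X (split_m _ P (mI _ _ mTA mX) mP) -NE.
  rewrite (split_m _ X (mI _ _ mTA mP) mX).
  rewrite [X in _ + X = _]null2; last 2 first.
  - by apply: measurableI; [exact: measurableI|exact: measurableC].
  - by move=> x [[]].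
  rewrite [X in _ = _ + X]null1; last 2 first.
  - by apply: measurableI => //; exact: measurableI.
  - by move=> x [[]].
  by rewrite setIAC.
have C0 : 0 <= C * len 1 [set: T] by exact: le_trans (mC _ measurableT).
pose p : {measure set T -> \bar R} := jordan_pos PN.
pose q : {measure set T -> \bar R} := jordan_neg PN.
have pE A : measurable A -> p A = (m (A `&` P))%:E.
  by move=> mA; rewrite [LHS]jordan_posE cjordan_posE /crestr0 mem_set// /crestr cE.
have qE A : measurable A -> q A = (- m (A `&` N))%:E.
  by move=> mA; rewrite [LHS]jordan_negE cjordan_negE /crestr0 mem_set// /crestr cE.
have leC A B : measurable A -> measurable B -> `|m (A `&` B)| <= `|C| * len 1 A.
  move=> mA mB; rewrite (le_trans (mC _ (mI _ _ mA mB)))//.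
  rewrite (@le_trans _ _ (`|C| * len 1 (A `&` B)))//.
    by rewrite ler_wpM2r ?len_ge0// ler_norm.
  rewrite ler_wpM2l// -lee_fin -!len_EFin//; last exact: measurableI.
  apply: le_measure; rewrite ?inE; [by apply: measurableI => //; exact: measurableI|exact: measurableI|].
  by apply: setSI; exact: subIsetl.
have [||a aP] := @invariant_measure_unique b `|C| nu p nuP.
- by move=> A mA; rewrite !pE ?inv//; exact: mpre.
- by move=> A mA; rewrite pE// lee_fin (le_trans (ler_norm _)) ?leC.
have [||a' a'P] := @invariant_measure_unique b `|C| nu q nuP.
- move=> A mA; rewrite !qE//; last exact: mpre.
  have := split_m _ P (mpre _ mA) mP; have := split_m _ P mA mP.
  by rewrite -NE inv// mT// => h1 h2; congr EFin; lra.
- by move=> A mA; rewrite qE// lee_fin (le_trans (ler_norm _)) ?normrN ?leC.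
exists (a - a') => A mA; have nuA : nu A \is a fin_num by exact: fin_num_measure.
have := aP _ mA; have := a'P _ mA; rewrite pE// qE// (split_m A P mA mP) -NE.
rewrite -(fineK nuA) -!EFinM => -[h1] -[h2]; congr EFin.
by rewrite mulrBl -h1 -h2 opprK.
Qed.

End charge_below_lebesgue.

(** * Weights of orbits *)

Section orbit_weights.
Context {R : realType} (T : R -> R) (x0 w : R).
Context (w_neq0 : w != 0) (w1 : `|w| < 1).
Implicit Types (y : R) (m n p : nat).

Definition periodic_pt y := exists2 m, (0 < m)%N & iter m T y = y.

(** For [T = negbeta b], [x0 = 1] and [w = -1/b] this is the jump [J(y)] of the density. *)
Definition hit_weight y := wsum w (fun n => (iter n T x0 == y)%:R).

(** The factor [Q(y)]: after the first hit of [y], further hits are the returns of [y] to itself. *)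
Definition return_weight y := wsum w (fun m => (iter m T y == y)%:R).

Definition first_hit n y :=
  iter n T x0 = y /\ forall m, (m < n)%N -> iter m T x0 != y.

Let boolR_le1 (c : nat -> bool) n : `|(c n)%:R| <= 1 :> R.
Proof. by rewrite normr_nat; case: (c n). Qed.

Lemma hit_weight_first n y : first_hit n y ->
  hit_weight y = w ^+ n * return_weight y.
Proof.
move=> [ny first].
rewrite /hit_weight (wsum_split w1 n (boolR_le1 (fun m => iter m T x0 == y))).
rewrite big1 ?add0r => [|i _].
  by congr (_ * _); apply: eq_wsum => m; rewrite iterD ny.
by rewrite (negbTE (first _ (ltn_ord i))) mulr0.
Qed.

Lemma first_hitE n y : iter n T x0 = y -> exists m, first_hit m y.
Proof.
move=> ny; have ex : exists m, iter m T x0 == y by exists n; apply/eqP.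
exists (ex_minn ex); case: ex_minnP => m /eqP my mmin; split => // k km.
by apply/negP => /mmin; rewrite leqNgt km.
Qed.

(** An earlier visit to the point at time [m], followed by [n - m] more steps, would hit [y] before
    time [n]. *)
Lemma first_hit_prev n m y : first_hit n y -> (m <= n)%N ->
  first_hit m (iter m T x0).
Proof.
move=> [ny first] mn; split => // k km; apply/negP => /eqP eqkm.
have knm : ((n - m) + k < n)%N by rewrite -ltn_subRL subKn.
by have /eqP[] := first _ knm; rewrite iterD eqkm -iterD subnK.
Qed.

Lemma return_weight_nonper y : ~ periodic_pt y -> return_weight y = 1.
Proof.
move=> nper; rewrite /return_weight.
rewrite (wsum_split w1 1 (boolR_le1 (fun m => iter m T y == y))).
rewrite big_ord1/= eqxx expr0 mulr1.
rewrite [X in _ * X](_ : _ = 0) ?mulr0 ?addr0//.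
apply: wsum0 => // n; case: eqP => // eqn; exfalso; apply: nper.
by exists (n + 1)%N => //; rewrite addn1.
Qed.

(** Shifting by one period gives [Q = 1 + w ^+ p * Q] for the return weight [Q]. *)
Lemma return_weight_period p y : (0 < p)%N -> iter p T y = y ->
  (forall m, (0 < m < p)%N -> iter m T y != y) ->
  return_weight y * (1 - w ^+ p) = 1.
Proof.
move=> p0 py pmin; rewrite mulrBr mulr1.
rewrite {1}/return_weight (wsum_split w1 p (boolR_le1 (fun m => iter m T y == y))).
case: p p0 py pmin => // p _ py pmin.
rewrite big_ord_recl big1 => [|i _]; last first.
  by rewrite (negbTE (pmin (lift ord0 i) (ltn_ord (lift ord0 i)))) mulr0.
rewrite /= eqxx expr0 mulr1 addr0 mulrC.
rewrite (_ : wsum _ _ = return_weight y); first by rewrite addrK.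
by apply: eq_wsum => m; rewrite iterD py.
Qed.

Lemma return_weight_neq0 y : return_weight y != 0.
Proof.
have [[p p0 py]|/return_weight_nonper->] := pselect (periodic_pt y); last first.
  exact: oner_neq0.
have ex : exists m, (0 < m)%N && (iter m T y == y) by exists p; rewrite p0 py/=.
case: (ex_minnP ex) => m /andP[m0 /eqP my] mmin.
have : return_weight y * (1 - w ^+ m) = 1.
  apply: return_weight_period => // k /andP[k0 km]; apply/negP => ky.
  by have := mmin k; rewrite k0 ky leqNgt km => /(_ isT).
by move=> h; apply: contraPneq h => ->; rewrite mul0r => /eqP; rewrite eq_sym oner_eq0.
Qed.

Lemma periodic_pt_iter n y : periodic_pt y -> periodic_pt (iter n T y).
Proof. by move=> [m m0 my]; exists m => //; rewrite -iterD addnC iterD my. Qed.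

Lemma return_weight_iter n y : periodic_pt y ->
  return_weight (iter n T y) = return_weight y.
Proof.
move=> [p p0 py]; apply: eq_wsum => m; rewrite -iterD addnC iterD.
congr ((_ : bool)%:R); apply/eqP/eqP => [eqn|-> //].
have pk k : iter (k * p) T y = y by elim: k => // k IH; rewrite mulSn iterD IH.
(* Another [n * p - n] steps carry [iter n T y] to [iter (n * p) T y = y], turning its return into
   one of [y]. *)
have np : (n <= n * p)%N by rewrite leq_pmulr.
have := congr1 (iter (n * p - n) T) eqn; rewrite -!iterD subnK// pk.
by rewrite [(_ + m)%N]addnC iterD pk.
Qed.

Lemma hit_weight_eq0 y : (forall n, iter n T x0 != y) -> hit_weight y = 0.
Proof.
by move=> h; apply: wsum0 => // n; rewrite (negbTE (h n)).
Qed.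

Lemma hit_weightP y : reflect (exists n, first_hit n y) (hit_weight y != 0).
Proof.
apply: (iffP idP) => [y0|[n ny]]; last first.
  by rewrite (hit_weight_first ny) mulf_neq0 ?expf_neq0 ?return_weight_neq0.
have [[n ny]|nex] := pselect (exists n, iter n T x0 = y).
  exact: first_hitE ny.
move: y0; rewrite hit_weight_eq0 ?eqxx// => n.
by apply/eqP => ny; apply: nex; exists n.
Qed.

End orbit_weights.

(** * Two orbits of one point with proportional hit weights *)

Section two_orbits.
Context {R : realType} (T1 T2 : R -> R) (x0 w1 w2 kappa : R).
Context (w1N : -1 < w1 < 0) (w2N : -1 < w2 < 0) (kappa_neq0 : kappa != 0).
Context (w1w2 : w1 <> w2).
Context (J12 :
  forall y, hit_weight T1 x0 w1 y = kappa * hit_weight T2 x0 w2 y).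
Context (per2 : periodic_pt T2 x0).

Let w1_neq0 : w1 != 0. Proof. by rewrite lt_eqF//; case/andP: w1N. Qed.
Let w2_neq0 : w2 != 0. Proof. by rewrite lt_eqF//; case/andP: w2N. Qed.
Let w1_lt1 : `|w1| < 1.
Proof. by case/andP: w1N => ? ?; rewrite ltr0_norm//; lra. Qed.
Let w2_lt1 : `|w2| < 1.
Proof. by case/andP: w2N => ? ?; rewrite ltr0_norm//; lra. Qed.

(** Nonzero hit weights detect orbit points, so proportional weights make both orbits visit the same
    points. *)
Let first_hit12 n y : first_hit T1 x0 n y -> exists k, first_hit T2 x0 k y.
Proof.
move=> ny; apply/(hit_weightP _ _ w2_neq0 w2_lt1).
have : hit_weight T1 x0 w1 y != 0.
  by apply/(hit_weightP _ _ w1_neq0 w1_lt1); exists n.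
by rewrite J12 mulf_eq0 negb_or => /andP[].
Qed.

Let first_hit21 n y : first_hit T2 x0 n y -> exists k, first_hit T1 x0 k y.
Proof.
move=> ny; apply/(hit_weightP _ _ w1_neq0 w1_lt1); rewrite J12 mulf_neq0//.
by apply/(hit_weightP _ _ w2_neq0 w2_lt1); exists n.
Qed.

(** The [T2]-orbit of the periodic point [x0] is a single cycle. *)
Let Q2_cst n y : first_hit T2 x0 n y ->
  return_weight T2 w2 y = return_weight T2 w2 x0.
Proof. by move=> [<- _]; rewrite return_weight_iter. Qed.

Let J12_first n k y : first_hit T1 x0 n y -> first_hit T2 x0 k y ->
  w1 ^+ n * return_weight T1 w1 y =
  kappa * (w2 ^+ k * return_weight T2 w2 x0).
Proof.
move=> ny ky; rewrite -(Q2_cst ky) -(hit_weight_first w2_lt1 ky) -J12.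
by rewrite (hit_weight_first w1_lt1 ny).
Qed.

(* Along the [T1]-orbit the weights of two points with the same return weight
   differ by a power of [w1], along the [T2]-orbit by [w2 ^+ (j - i)]; comparing
   also with the immediate [T1]-successor of the first point leaves no room
   for [w1 <> w2] when [j - i <= 2]. *)
Let no_twins i j yi yj : (i < j <= i.+2)%N ->
  first_hit T2 x0 i yi -> first_hit T2 x0 j yj ->
  (periodic_pt T1 yi <-> periodic_pt T1 yj) -> False.
Proof.
move=> /andP[ij ji2] hi hj perij.
have [ni hni] := first_hit21 hi; have [nj hnj] := first_hit21 hj.
have Ei := J12_first hni hi; have Ej := J12_first hnj hj.
set Q' := return_weight T2 w2 x0 in Ei Ej *.
have Q'0 : Q' != 0 by exact: return_weight_neq0.
have Qij : return_weight T1 w1 yj = return_weight T1 w1 yi.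
  have [pi|npi] := pselect (periodic_pt T1 yi); last first.
    by rewrite !return_weight_nonper// => /perij.
  have pj := perij.1 pi; move: hni hnj => [eqi _] [eqj _].
  (* Whichever point is hit first leads to the other along [T1], so both lie on one cycle. *)
  have [nij|/ltnW nij] := leqP ni nj.
    rewrite -{1}eqj -(subnK nij) iterD eqi.
    by rewrite return_weight_iter.
  rewrite -[in RHS]eqi -(subnK nij) iterD eqj.
  by rewrite return_weight_iter.
rewrite Qij in Ej; set Q := return_weight T1 w1 yi in Ei Ej *.
have Q0 : Q != 0 by exact: return_weight_neq0.
have nw1 : 0 < `|w1| by rewrite normr_gt0.
have nw2 : 0 < `|w2| by rewrite normr_gt0.
(* The quotient of [Ei] and [Ej], cross-multiplied; since [i < j], absolute values can balance only
   if [ni < nj]. *)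
have E1 : w1 ^+ nj * w2 ^+ i = w1 ^+ ni * w2 ^+ j.
  apply: (mulIf (mulf_neq0 (mulf_neq0 Q0 kappa_neq0) Q'0)).
  transitivity (w1 ^+ nj * Q * (kappa * (w2 ^+ i * Q'))); first ring.
  by rewrite Ej -Ei; ring.
have nij : (ni < nj)%N.
  rewrite ltnNge; apply/negP => nji; have := congr1 Num.norm E1.
  rewrite !normrM !normrX => /eqP; apply/negP; rewrite gt_eqF//.
  rewrite (@lt_le_trans _ _ (`|w1| ^+ ni * `|w2| ^+ i))//.
    by rewrite ltr_pM2l ?exprn_gt0// ltr_iXn2l.
  by rewrite ler_pM2r ?exprn_gt0// ler_iXn2l.
have E2 : w1 ^+ (nj - ni) = w2 ^+ (j - i).
  apply: (mulIf (mulf_neq0 (expf_neq0 ni w1_neq0) (expf_neq0 i w2_neq0))).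
  rewrite [LHS]mulrA -exprD subnK ?(ltnW nij)// E1.
  by rewrite mulrCA -exprD subnK// ltnW.
(* The successor of [yi] occurs no later than [nj], so this is again a first hit, and its return
   weight is still [Q]. *)
pose z := iter ni.+1 T1 x0; have hz : first_hit T1 x0 ni.+1 z.
  exact: first_hit_prev hnj nij.
have zE : z = T1 yi by rewrite /z iterS; case: hni => ->.
have Qz : return_weight T1 w1 z = Q.
  have [pi|npi] := pselect (periodic_pt T1 yi).
    by rewrite zE -[T1 yi]/(iter 1 T1 yi) return_weight_iter.
  rewrite /Q !return_weight_nonper// => pz; apply/npi/perij.
  case: hnj => <- _; rewrite -(subnK nij) iterD.
  exact: periodic_pt_iter.
have [k hk] := first_hit12 hz.
have Ek := J12_first hz hk; rewrite Qz -/Q' in Ek.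
have E3 : w1 * w2 ^+ i = w2 ^+ k.
  apply: (mulIf (mulf_neq0 (mulf_neq0 (mulf_neq0 Q0 kappa_neq0) Q'0)
    (expf_neq0 ni w1_neq0))).
  transitivity (w1 ^+ ni.+1 * Q * (kappa * (w2 ^+ i * Q'))).
    by rewrite exprS; ring.
  by rewrite Ek -Ei; ring.
have ik : (i < k)%N.
  rewrite ltnNge; apply/negP => ki; have := congr1 Num.norm E3.
  rewrite !normrM !normrX => /eqP; apply/negP; rewrite lt_eqF//.
  rewrite (@lt_le_trans _ _ (`|w2| ^+ i))//.
    by rewrite gtr_pMl ?exprn_gt0.
  by rewrite ler_iXn2l.
have E4 : w1 = w2 ^+ (k - i).
  apply: (mulIf (expf_neq0 i w2_neq0)).
  by rewrite -exprD subnK// ltnW.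
(* Substituting [E4] into the absolute value of [E2] compares two powers of [|w2| < 1]. *)
have E5 : ((k - i) * (nj - ni) = j - i)%N.
  have := congr1 Num.norm E2; rewrite {1}E4 -exprM !normrX => h.
  apply/eqP; rewrite eqn_leq -!(ler_iXn2l nw2 w2_lt1).
  by rewrite h lexx.
(* [k - i] divides [j - i], which is 1 or 2. The value 1 gives [w1 = w2]; the value 2 makes [w1] a
   square, against [w1 < 0]. *)
have ki2 : (k - i = 1 \/ k - i = 2)%N by nia.
case: ki2 => ki; rewrite ki in E4; first by apply: w1w2; rewrite E4 expr1.
by case/andP: w1N => _; rewrite E4 ltNge sqr_ge0.
Qed.

(** By [no_twins], [x0] and [T2 x0] differ in periodicity under [T1]. A third point [T2 (T2 x0)]
    would agree with one of them, at most 2 steps away on the [T2]-orbit. *)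
Lemma periodic_orbits_2 : T2 x0 != x0 ->
  [/\ ~ periodic_pt T1 x0, T1 (T1 x0) = T1 x0 & T2 (T2 x0) = x0].
Proof.
move=> T2x0.
have h0 : first_hit T2 x0 0 x0 by split.
have h1 : first_hit T2 x0 1 (T2 x0).
  by split=> //= -[|//] _; rewrite eq_sym.
have nper : ~ periodic_pt T1 x0.
  move=> per; apply: (no_twins _ h0 h1) => //; split=> // _.
  have [n [<- _]] := first_hit21 h1; exact: periodic_pt_iter.
have per1 : periodic_pt T1 (T2 x0).
  apply: contrapT => nper1; exact: (no_twins _ h0 h1).
have T22 : T2 (T2 x0) = x0.
  apply: contrapT => /eqP T22.
  (* Otherwise the [T2]-orbit would stay at [T2 x0] and never return to [x0]. *)
  have T22' : T2 (T2 x0) != T2 x0.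
    apply/eqP => fix2; have fixn n : iter n.+1 T2 x0 = T2 x0.
      by elim: n => // n IH; rewrite iterS IH.
    have [[//|m] _] := per2; rewrite fixn => /eqP; exact/negP.
  have h2 : first_hit T2 x0 2 (T2 (T2 x0)).
    by split=> //= -[|[|//]] _; rewrite eq_sym.
  have [per|nper2] := pselect (periodic_pt T1 (T2 (T2 x0))).
    exact: (no_twins _ h1 h2).
  exact: (no_twins _ h0 h2).
have orb2 n : iter n T2 x0 = x0 \/ iter n T2 x0 = T2 x0.
  elim: n => [|n [] IH]; first by left.
    by right; rewrite iterS IH.
  by left; rewrite iterS IH.
(* The [T1]-orbit visits only [x0] and [T2 x0], and cannot return to [x0], which is not periodic for
   [T1]. *)
have orb1 n : iter n.+1 T1 x0 = T2 x0.
  have [k hk] := first_hitE (erefl (iter n.+1 T1 x0)).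
  have [l [ly _]] := first_hit12 hk.
  have [lx0|<- //] := orb2 l; exfalso; apply: nper.
  by exists n.+1 => //; rewrite -ly lx0.
have := orb1 0%N; have := orb1 1%N; rewrite !iterS/= => -> T1x0.
by split=> //; rewrite T1x0.
Qed.

End two_orbits.

(** * The density of the invariant measure *)

Lemma tent_second_difference {R : realType} (e t y : R) : 0 < e ->
  2 * Num.min y t - Num.min (y - e) t - Num.min (y + e) t =
  Num.max 0 (e - `|t - y|).
Proof.
move=> e0; rewrite !minEle maxEle.
have [h|h] := lerP 0 (t - y); [rewrite (ger0_norm h)|rewrite (ltr0_norm h)];
  have [h1|h1] := lerP y t; have [h2|h2] := lerP (y - e) t;
  have [h3|h3] := lerP (y + e) t;
  (case: ifP => [|/negbT]; rewrite -?ltNge => h4); lra.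
Qed.

Section signed_density.
Context {R : realType} (b : R) (b1 : 1 < b).
Implicit Types (A B : set (measurableTypeR R)) (x y : R).

Let w : R := - b^-1.
Let t n := iter n (negbeta b) 1.

Lemma negbeta_weight_itv : -1 < - b^-1 < 0.
Proof.
have b0 : 0 < b := lt_trans ltr01 b1.
by rewrite ltrN2 invf_lt1// b1 oppr_lt0 invr_gt0.
Qed.

Lemma norm_negbeta_weight_lt1 : `|- b^-1| < 1.
Proof. by have /andP[? ?] := negbeta_weight_itv; rewrite ltr0_norm//; lra. Qed.

Let w1 : `|w| < 1 := norm_negbeta_weight_lt1.

Lemma iter_negbeta_itv n : 0 < t n <= 1.
Proof.
case: n => [|n]; first by rewrite /t/= ltr01 lexx.
by have := negbeta_itv b (t n); rewrite /t /= in_itv.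
Qed.

(* The signed measure whose density is the function h_{-b} of the paper. *)
Definition parry_charge A := wsum w (fun n => len (t n) A).

Let len_orbit_le A n : measurable A -> `|len (t n) A| <= len 1 A.
Proof.
move=> mA; rewrite ger0_norm ?len_ge0// le_len//.
by have /andP[] := iter_negbeta_itv n.
Qed.

Lemma parry_chargeU A B : measurable A -> measurable B -> A `&` B = set0 ->
  parry_charge (A `|` B) = parry_charge A + parry_charge B.
Proof.
move=> mA mB AB.
rewrite -(wsumD w1 (fun n => len_orbit_le n mA) (fun n => len_orbit_le n mB)).
by apply: eq_wsum => n; rewrite len_setU.
Qed.

Lemma ler_norm_parry_charge A : measurable A ->
  `|parry_charge A| <= (1 - `|w|)^-1 * len 1 A.
Proof.
move=> mA; rewrite mulrC.
exact: ler_norm_wsum (fun n => len_orbit_le n mA).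
Qed.

(* By [len_negbeta] the two series differ by a telescoping one. *)
Lemma parry_charge_invariant A : measurable A ->
  parry_charge (negbeta b @^-1` A) = parry_charge A.
Proof.
move=> mA; have b0 : 0 < b := lt_trans ltr01 b1.
have t1 n : `|t n| <= 1.
  by have /andP[t0 t1] := iter_negbeta_itv n; rewrite gtr0_norm.
have tS1 n : `|t n.+1| <= 1 by [].
have LA n := len_orbit_le n mA; have LSA n : `|len (t n.+1) A| <= len 1 A by [].
have E n : len (t n) (negbeta b @^-1` A) =
    len 1 A * t n + (w * len (t n.+1) A - w * len 1 A * t n.+1).
  have /andP[/ltW tn0 _] := iter_negbeta_itv n.
  have := len_negbeta b0 tn0 mA; rewrite -[negbeta b (t n)]/(t n.+1) /w.
  by move: (len _ _) (len _ _) => u v; lra.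
rewrite /parry_charge (eq_wsum _ E).
have c1 n : `|len 1 A * t n| <= len 1 A.
  by rewrite normrM ger0_norm ?len_ge0// ler_piMr ?len_ge0.
have c2 n : `|w * len (t n.+1) A| <= len 1 A.
  by rewrite normrM (le_trans _ (LSA n))// ler_piMl// ltW.
have c3 n : `|w * len 1 A * t n.+1| <= len 1 A.
  rewrite -mulrA mulrCA normrM ger0_norm ?len_ge0// ler_piMr ?len_ge0//.
  by rewrite normrM mulr_ile1// ltW.
have c4 n : `|w * len (t n.+1) A - w * len 1 A * t n.+1| <= len 1 A + len 1 A.
  by rewrite (le_trans (ler_normB _ _))// lerD.
rewrite (wsumD w1 c1 c4) (wsumB w1 c2 c3).
rewrite (wsumZ w1 _ t1) (wsumZ w1 _ LSA) (wsumZ w1 _ tS1).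
(* Once the first terms [t 0 = 1] and [len 1 A] are split off, the shifted sums cancel. *)
rewrite (wsum_recl w1 t1) (wsum_recl w1 LA).
have -> : t 0 = 1 by [].
set u := wsum _ _; set v := wsum _ _; ring.
Qed.

Lemma parry_charge_itvoc x : 0 <= x ->
  parry_charge `]0, x]%classic = wsum w (fun n => Num.min x (t n)).
Proof.
move=> x0; apply: eq_wsum => n; rewrite len_itvoc//.
by have /andP[/ltW] := iter_negbeta_itv n.
Qed.

(** For fixed [n], [Num.min x (t n) = x] once [x <= t n], so the quotient tends termwise to the
    geometric series of [w]. *)
Lemma cvg_parry_charge_0 :
  parry_charge `]0, x]%classic / x @[x --> 0^'+] --> (1 - w)^-1.
Proof.
rewrite -div1r -(wsum_cst w1).
(* Dividing by [|x|] keeps [u] bounded by 1 for every [x], as [cvg_wsum_near] demands, and changes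
   nothing for [x > 0]. *)
pose u x n := Num.min 1 (t n / `|x|).
have tn n := iter_negbeta_itv n.
have uc : wsum w (u x) @[x --> 0^'+] --> wsum w (fun=> 1).
  apply: (@cvg_wsum_near _ _ w1 _ _ 1) => [x n|n|n]; rewrite ?normr1//.
  - rewrite ger0_norm; first by rewrite ge_min lexx.
    rewrite le_min ler01 divr_ge0//.
    by have /andP[/ltW] := tn n.
  - have /andP[tn0 _] := tn n.
    near=> x; have x0 : 0 < x by [].
    apply/min_idPl; rewrite ler_pdivlMr ?normr_gt0 ?gt_eqF// mul1r gtr0_norm//.
    by near: x; apply: nbhs_right_le.
apply: cvg_trans uc; apply: near_eq_cvg; near=> x.
have x0 : 0 < x by [].
rewrite parry_charge_itvoc ?ltW// mulrC -(wsumZ (M := `|x|) w1) => [|n]; last first.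
  have /andP[tn0 _] := tn n.
  rewrite !ger0_norm ?le_min ?(ltW x0) ?(ltW tn0)//.
  by rewrite ge_min lexx.
apply: eq_wsum => n; rewrite /u gtr0_norm// minr_pMr ?invr_ge0 ?ltW//.
by rewrite mulVf ?gt_eqF// [_^-1 * _]mulrC.
Unshelve. all: by end_near. Qed.

(* The density of [parry_charge] jumps at [y] by the total weight of the
   orbit times landing on [y]; the jump is read off second differences, which
   turn each [min x (t n)] into a tent function of width [e] centred at [y]. *)
Lemma cvg_parry_charge_jump y : 0 < y ->
  (parry_charge `]0, y]%classic *+ 2 - parry_charge `]0, y - e]%classic
    - parry_charge `]0, y + e]%classic) / e @[e --> 0^'+] -->
  hit_weight (negbeta b) 1 w y.
Proof.
move=> y0; pose u (e : R) n : R := Num.max 0 (1 - `|t n - y| / `|e|).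
have uc : wsum w (u e) @[e --> 0^'+] --> hit_weight (negbeta b) 1 w y.
  apply: (@cvg_wsum_near _ _ w1 _ _ 1) => [e n|n|n].
  - rewrite ger0_norm; last by rewrite le_max lexx.
    by rewrite ge_max ler01 gerBl divr_ge0.
  - by rewrite normr_nat; case: (_ == _).
  - have [ty|ty] := eqVneq (t n) y.
      near=> e; rewrite /u ty subrr normr0 mul0r subr0.
      by apply/max_idPr; exact: ler01.
    near=> e; rewrite /u; have e0 : 0 < e by [].
    apply/max_idPl; rewrite subr_le0 ler_pdivlMr ?normr_gt0 ?gt_eqF//.
    rewrite mul1r gtr0_norm//; near: e; apply: nbhs_right_le.
    by rewrite normr_gt0 subr_eq0.
apply: cvg_trans uc; apply: near_eq_cvg; near=> e.
have e0 : 0 < e by [].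
have ey : e < y by near: e; exact: nbhs_right_lt.
have bnd x n : 0 <= x -> `|Num.min x (t n)| <= x.
  have /andP[tn0 _] := iter_negbeta_itv n => x0.
  by rewrite ger0_norm ?ge_min ?lexx// le_min x0 ltW.
have b1' n := bnd y n (ltW y0).
have b2 n : `|2 * Num.min y (t n)| <= 2 * y by rewrite normrM gtr0_norm// ler_pM2l.
have b3 n : `|Num.min (y - e) (t n)| <= y - e by apply: bnd; lra.
have b4 n : `|Num.min (y + e) (t n)| <= y + e by apply: bnd; lra.
have b5 n : `|2 * Num.min y (t n) - Num.min (y - e) (t n)| <= 2 * y + (y - e).
  by rewrite (le_trans (ler_normB _ _))// lerD.
have b6 n : `|2 * Num.min y (t n) - Num.min (y - e) (t n)
    - Num.min (y + e) (t n)| <= 2 * y + (y - e) + (y + e).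
  by rewrite (le_trans (ler_normB _ _))// lerD.
rewrite !parry_charge_itvoc; [|lra|lra|lra].
rewrite -mulr_natl -(wsumZ w1 _ b1') -(wsumB w1 b2 b3) -(wsumB w1 b5 b4) mulrC.
rewrite -(wsumZ w1 _ b6); apply: eq_wsum => n.
have e_neq0 := lt0r_neq0 e0.
have uE : u e n = e^-1 * Num.max 0 (e - `|t n - y|).
  rewrite /u (gtr0_norm e0) maxr_pMr ?invr_ge0 ?(ltW e0)// mulr0; congr Num.max.
  by field.
rewrite uE; congr (_ * _).
exact/esym/tent_second_difference.
Unshelve. all: by end_near. Qed.

End signed_density.

(** * Comparison of two negative beta-transformations *)

Lemma parry_charge_acip {R : realType} (b : R)
    (nu : probability (measurableTypeR R) R) : 1 < b -> is_nu_negbeta b nu ->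
  exists2 a : R, a != 0 &
    forall A, measurable A -> parry_charge b A = a * fine (nu A).
Proof.
move=> b1 nuP; have b0 : 0 <= b by rewrite ltW// (lt_trans ltr01).
have [a aP] := invariant_charge_unique b0 nuP (parry_chargeU b1)
  (ler_norm_parry_charge b1) (parry_charge_invariant b1).
have aE A : measurable A -> parry_charge b A = a * fine (nu A).
  move=> mA; apply: EFin_inj; rewrite aP// EFinM fineK//.
  exact: fin_num_measure.
exists a => //; apply/eqP => a0.
have := cvg_parry_charge_0 b1.
rewrite (_ : (fun x => _) = cst 0); last first.
  by apply/funext => x; rewrite aE// a0 !mul0r.
move=> /(cvg_unique (@Rhausdorff R) (cvg_cst _)) /esym/eqP.
by rewrite invr_eq0; have /andP[_] := negbeta_weight_itv b1; lra.
Qed.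

Lemma proportional_hit_weights {R : realType} (b1 b2 kappa : R) :
  1 < b1 -> 1 < b2 ->
  (forall A, measurable A -> parry_charge b1 A = kappa * parry_charge b2 A) ->
  (1 - - b1^-1)^-1 = kappa * (1 - - b2^-1)^-1 /\
  forall y, hit_weight (negbeta b1) 1 (- b1^-1) y =
    kappa * hit_weight (negbeta b2) 1 (- b2^-1) y.
Proof.
move=> b1_gt1 b2_gt1 E; split.
  have := cvg_parry_charge_0 b1_gt1.
  rewrite (_ : (fun x => _) =
      fun x => kappa * (parry_charge b2 `]0, x]%classic / x)); last first.
    by apply/funext => x; rewrite E// mulrA.
  by move=> h; apply: (cvg_unique (@Rhausdorff R) h);
    apply: cvgMr; exact: cvg_parry_charge_0.
move=> y; have [y0|y0] := leP y 0.
  have nohit b n : iter n (negbeta b) 1 != y.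
    by have /andP[h _] := iter_negbeta_itv b n; rewrite gt_eqF// (le_lt_trans y0).
  by rewrite !hit_weight_eq0 ?mulr0//; exact: norm_negbeta_weight_lt1.
have := cvg_parry_charge_jump b1_gt1 y0.
rewrite (_ : (fun e => _) = fun e => kappa *
  ((parry_charge b2 `]0, y]%classic *+ 2 - parry_charge b2 `]0, y - e]%classic
    - parry_charge b2 `]0, y + e]%classic) / e)); last first.
  by apply/funext => e; rewrite !E//; ring.
by move=> h; apply: (cvg_unique (@Rhausdorff R) h);
  apply: cvgMr; exact: cvg_parry_charge_jump.
Qed.

(** [negbeta b 1] is 1 minus the fractional part of [b]. *)
Lemma negbeta1_neq1 {R : realType} (b : R) : b \isn't a Num.int ->
  negbeta b 1 != 1.
Proof.
apply: contraNneq => /eqP; rewrite /negbeta mulr1 -subr_eq0 addrK addrC subr_eq0.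
by move=> /eqP <-; exact: intr_int.
Qed.

Lemma quadratic_shift_of_periodic {R : realType} (b1 b2 kappa : R) :
  1 < b1 -> 1 < b2 -> b1 \isn't a Num.int -> b2 \isn't a Num.int ->
  b1 <> b2 -> kappa != 0 ->
  (1 - - b1^-1)^-1 = kappa * (1 - - b2^-1)^-1 ->
  (forall y, hit_weight (negbeta b1) 1 (- b1^-1) y =
    kappa * hit_weight (negbeta b2) 1 (- b2^-1) y) ->
  periodic_pt (negbeta b2) 1 -> quadratic_shift b1 b2.
Proof.
move=> b1_gt1 b2_gt1 b1Z b2Z b12 kappa0 E0 J12 per2.
have b10 : 0 < b1 := lt_trans ltr01 b1_gt1.
have b20 : 0 < b2 := lt_trans ltr01 b2_gt1.
have w1N := negbeta_weight_itv b1_gt1; have w2N := negbeta_weight_itv b2_gt1.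
have w12 : - b1^-1 <> - b2^-1 by move=> /oppr_inj/invr_inj.
have w1_lt1 := norm_negbeta_weight_lt1 b1_gt1.
have w2_lt1 := norm_negbeta_weight_lt1 b2_gt1.
have [nper1 fix1 fix2] :=
  periodic_orbits_2 w1N w2N kappa0 w12 J12 per2 (negbeta1_neq1 b2Z).
have first0 T : first_hit T (1 : R) 0 1 by [].
have Q2 : return_weight (negbeta b2) (- b2^-1) 1 * (1 - (- b2^-1) ^+ 2) = 1.
  apply: return_weight_period => // -[|[|//]]// _; exact: negbeta1_neq1.
have := J12 1.
rewrite (hit_weight_first w1_lt1 (first0 _)) (hit_weight_first w2_lt1 (first0 _)).
rewrite !expr0 !mul1r return_weight_nonper// => J1.
(* The jumps at 1 read [1 = kappa * Q], where [Q] is the return weight for period 2. *)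
have kE : kappa = 1 - (- b2^-1) ^+ 2.
  by rewrite -[LHS]mulr1 -[in LHS]Q2 mulrA -J1 mul1r.
(* The limits at 0 become [b1 / (b1 + 1) = (b2 - 1) / b2]. *)
have b2E : b2 = b1 + 1.
  have b11 : b1 + 1 != 0 by rewrite gt_eqF// addr_gt0.
  have b21 : b2 + 1 != 0 by rewrite gt_eqF// addr_gt0.
  have h1 : (1 - - b1^-1)^-1 = b1 / (b1 + 1) by field; rewrite ?b11 ?b21 ?gt_eqF.
  have h2 : kappa * (1 - - b2^-1)^-1 = (b2 - 1) / b2.
    by rewrite kE; field; rewrite ?b11 ?b21 ?gt_eqF.
  have := E0; rewrite h1 h2 => /(congr1 (fun x => x * (b1 + 1) * b2)).
  rewrite mulfVK// [X in _ = X -> _](_ : _ = (b2 - 1) * (b1 + 1)).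
    by lra.
  by field; rewrite gt_eqF.
(* The witnesses are [q = m] and [p = m - z]; [pE] is the fixed-point equation at
   [negbeta b1 1 = m + 1 - b1]. *)
pose m := Num.floor b1; pose z := Num.floor (b1 * negbeta b1 1).
have /andP[mb bm] := floor_itv b1; rewrite -/m intrD in mb bm.
have mb' : m%:~R < b1.
  by rewrite lt_neqAle mb andbT; apply: contraNneq b1Z => <-; exact: intr_int.
have T1E : negbeta b1 1 = m%:~R + 1 - b1 by rewrite /negbeta mulr1 -/m; ring.
have pE : (m - z)%:~R = b1 * (b1 - m%:~R).
  have := fix1; rewrite {1}/negbeta -/z T1E intrB => h; lra.
have m_gt0 : 0 < m by rewrite -(ltr_int R); lra.
have p_gt0 : 0 < m - z by rewrite -(ltr_int R) pE mulr_gt0// subr_gt0.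
(* [b1 * (b1 - m) < b1 < m + 1], and an integer below [m + 1] is at most [m]. *)
have p_le : m - z <= m.
  rewrite -ltzD1 -(ltr_int R) pE intrD (lt_trans _ bm)//.
  by rewrite gtr_pMr//; lra.
have pR : `|m - z|%N%:R = (m - z)%:~R :> R.
  by rewrite -[in RHS](gez0_abs (ltW p_gt0)).
have mR : `|m|%N%:R = m%:~R :> R.
  by rewrite -[in RHS](gez0_abs (ltW m_gt0)).
exists `|m - z|%N, `|m|%N; split => //.
- by rewrite absz_gt0 gt_eqF.
- by rewrite absz_gt0 gt_eqF.
- by rewrite -lez_nat !gez0_abs// ltW.
- by rewrite pR mR pE; ring.
Qed.

(** With [t = q + 1 - b1], the orbit of 1 is [1, t, t, ...] for [b1] and [1, t, 1, t, ...] for [b2],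
    so both series have closed forms. *)
Lemma parry_charge_quadratic_shift {R : realType} (b1 b2 : R) A :
  1 < b1 -> quadratic_shift b1 b2 -> measurable A ->
  parry_charge b1 A = (1 - b2^-1 ^+ 2) * parry_charge b2 A.
Proof.
move=> b1_gt1 [p [q [p0 q0 pq eqb b2E]]] mA.
have b10 : 0 < b1 := lt_trans ltr01 b1_gt1.
have b2_gt1 : 1 < b2 by lra.
have b20 : 0 < b2 := lt_trans ltr01 b2_gt1.
have p0' : 0 < p%:R :> R by rewrite ltr0n.
have pq' : p%:R <= q%:R :> R by rewrite ler_nat.
have eqb' : b1 * (b1 - q%:R) = p%:R by lra.
have qb : q%:R < b1 by rewrite -subr_gt0 -(pmulr_rgt0 _ b10) eqb'.
(* [b1 * (b1 - q) = p <= q < b1] forces [b1 - q < 1], so [q] is the floor of [b1]. *)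
have bq : b1 < q%:R + 1.
  by rewrite -ltrBlDl -(ltr_pM2l b10) eqb' mulr1 (le_lt_trans pq').
pose t := q%:R + 1 - b1.
have T1 : negbeta b1 1 = t.
  by rewrite (@negbeta_branch _ _ _ q) mulr1 -[q.+1%:R]natr1//; apply/andP; split; lra.
have T1t : negbeta b1 t = t.
  have b1t : b1 * t = b1 - p%:R by rewrite /t -eqb'; ring.
  rewrite (@negbeta_branch _ _ _ (q - p)) b1t -[(q - p).+1%:R]natr1 natrB//.
    by rewrite /t; lra.
  by apply/andP; split; lra.
have T2 : negbeta b2 1 = t.
  rewrite (@negbeta_branch _ _ _ q.+1) mulr1 -[q.+2%:R]natr1 -[q.+1%:R]natr1.
    by rewrite /t b2E; lra.
  by rewrite b2E; apply/andP; split; lra.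
(* The map takes the value 1 wherever [b2 * x] is an integer, here [q + 1 - p]. *)
have T2t : negbeta b2 t = 1.
  have b2t : b2 * t = q%:R + 1 - p%:R by rewrite b2E /t -eqb'; ring.
  have pq1 : (p <= q.+1)%N by exact: leqW.
  rewrite (@negbeta_branch _ _ _ (q.+1 - p)) b2t -[(q.+1 - p).+1%:R]natr1
    natrB// -[q.+1%:R]natr1; first lra.
  by apply/andP; split; lra.
have w1_lt1 := norm_negbeta_weight_lt1 b1_gt1.
have w2_lt1 := norm_negbeta_weight_lt1 b2_gt1.
have bnd b n : `|len (iter n (negbeta b) 1) A| <= len 1 A.
  rewrite ger0_norm ?len_ge0// le_len//.
  by have /andP[] := iter_negbeta_itv b n.
have S1 : parry_charge b1 A = len 1 A + - b1^-1 * (len t A / (1 - - b1^-1)).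
  rewrite /parry_charge (wsum_recl w1_lt1 (bnd b1)) -(wsum_cst w1_lt1).
  congr (_ + _ * _); apply: eq_wsum => n; congr (len _ _).
  by elim: n => [//|n IH]; rewrite iterS IH.
(* Dropping two terms reproduces the series, which gives a linear equation for its sum. *)
have S2 : parry_charge b2 A =
    len 1 A + - b2^-1 * (len t A + - b2^-1 * parry_charge b2 A).
  rewrite {1}/parry_charge (wsum_recl w2_lt1 (bnd b2)).
  rewrite (wsum_recl w2_lt1 (fun n => bnd b2 n.+1)).
  rewrite [iter 1 _ _]T2; congr (_ + _ * (_ + _ * _)).
  by apply: eq_wsum => n; rewrite -(addn2 n) iterD/= T2 T2t.
rewrite S1 mulrBl mul1r {1}S2 b2E.
have b11 : b1 + 1 != 0 by rewrite gt_eqF// addr_gt0.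
by field; rewrite ?b11 ?gt_eqF.
Qed.

Lemma measure_eq_quadratic_shift {R : realType} (b1 b2 : R)
    (nu1 nu2 : probability (measurableTypeR R) R) : 1 < b1 ->
  is_nu_negbeta b1 nu1 -> is_nu_negbeta b2 nu2 ->
  quadratic_shift b1 b2 -> measure_eq nu1 nu2.
Proof.
move=> b1_gt1 nu1P nu2P b12.
have b2_gt1 : 1 < b2 by case: b12 => p [q [_ _ _ _ ->]]; lra.
have [a1 a1_neq0 E1] := parry_charge_acip b1_gt1 nu1P.
have [a2 a2_neq0 E2] := parry_charge_acip b2_gt1 nu2P.
have E A : measurable A -> a1 * fine (nu1 A) = (1 - b2^-1 ^+ 2) * a2 * fine (nu2 A).
  by move=> mA; rewrite -E1// -mulrA -E2// (parry_charge_quadratic_shift b1_gt1 b12 mA).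
have [[nu11 _ _] _] := nu1P; have [[nu21 _ _] _] := nu2P.
(* Both measures give []0, 1]] mass 1, which identifies the two factors. *)
have aE : a1 = (1 - b2^-1 ^+ 2) * a2.
  by have := E `]0, 1]%classic (measurable_itv _); rewrite nu11 nu21/= !mulr1.
move=> A mA; have := E A mA; rewrite -aE => /(mulfI a1_neq0) h.
by rewrite -[LHS]fineK ?fin_num_measure// h fineK ?fin_num_measure.
Qed.

Theorem theorem1p3 (R : realType) (b1 b2 : R)
    (nu1 nu2 : probability (measurableTypeR R) R)
    (b1_gt1 : 1 < b1) (b2_gt1 : 1 < b2)
    (b1_nint : b1 \isn't a Num.int) (b2_nint : b2 \isn't a Num.int)
    (b1_neq_b2 : b1 <> b2)
    (nu1P : is_nu_negbeta b1 nu1) (nu2P : is_nu_negbeta b2 nu2) :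
  measure_eq nu1 nu2 <-> (quadratic_shift b1 b2 \/ quadratic_shift b2 b1).
Proof.
split=> [nu12|[b12|b21]]; last 2 first.
- exact: measure_eq_quadratic_shift b12.
- by move=> A mA; apply/esym; exact: (measure_eq_quadratic_shift b2_gt1 nu2P nu1P b21).
have [a1 a1_neq0 E1] := parry_charge_acip b1_gt1 nu1P.
have [a2 a2_neq0 E2] := parry_charge_acip b2_gt1 nu2P.
have E12 A : measurable A -> parry_charge b1 A = a1 / a2 * parry_charge b2 A.
  by move=> mA; rewrite E1// E2// nu12// mulrA divfK.
have E21 A : measurable A -> parry_charge b2 A = a2 / a1 * parry_charge b1 A.
  by move=> mA; rewrite E1// E2// nu12// mulrA divfK.
have [D12 J12] := proportional_hit_weights b1_gt1 b2_gt1 E12.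
have [D21 J21] := proportional_hit_weights b2_gt1 b1_gt1 E21.
have [per2|nper2] := pselect (periodic_pt (negbeta b2) 1).
  left; apply: quadratic_shift_of_periodic D12 J12 per2 => //.
  by rewrite mulf_neq0 ?invr_neq0.
have [per1|nper1] := pselect (periodic_pt (negbeta b1) 1).
  right; apply: quadratic_shift_of_periodic D21 J21 per1 => //.
    exact/nesym.
  by rewrite mulf_neq0 ?invr_neq0.
(* Neither orbit returns to 1, so the jumps at 1 give [a1 / a2 = 1] and the limits at 0 coincide. *)
exfalso; apply: b1_neq_b2.
have first0 T : first_hit T (1 : R) 0 1 by [].
have w1_lt1 := norm_negbeta_weight_lt1 b1_gt1.
have w2_lt1 := norm_negbeta_weight_lt1 b2_gt1.
have := J12 1.
rewrite (hit_weight_first w1_lt1 (first0 _)) (hit_weight_first w2_lt1 (first0 _)).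
rewrite !return_weight_nonper// !expr0 !mulr1 => k1.
move: D12; rewrite -k1 mul1r => /invr_inj/addrI/oppr_inj/oppr_inj.
exact: invr_inj.
Qed.
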